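(* Let $F$ be an algebraic extension of $\mathbb{Q}_2$ of (finite) ramification index $e$, with ring of integers $\mathfrak{o}$ and prime ideal $\mathfrak{p}$, and let $n,m\ge 0$ be integers. If $e\ge m$ and $n\ge m$, then $\mathrm{K}_n^m$ is a normal subgroup of $\mathrm{K}=\mathrm{SL}_2(\mathfrak{o})$.
   Context: $\mathfrak{p}$ is the prime (maximal) ideal of $\mathfrak{o}$, generated by a uniformizer $\varpi$; the valuation is normalized so that $\mathrm{v}(\varpi)=1$, so $\mathrm{v}(2)=e$. $\mathfrak{p}^0=\mathfrak{o}$. For integers $n,m\ge 0$, $\mathrm{K}_n^m$ denotes the subgroup of $\mathrm{SL}_2(F)$ consisting of the determinant-one matrices of the form $1_2+\begin{pmatrix} a & b\\ c& d\end{pmatrix}$ with $a,d\in\mathfrak{p}^n$ and $b,c\in\mathfrak{p}^{n+m}$. *)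

(* Defs.v *)
From HB Require Import structures.
From mathcomp Require Import all_boot all_order all_algebra.
From mathcomp Require Import boolp.

Set Implicit Arguments.
Unset Strict Implicit.
Unset Printing Implicit Defensive.

Import GRing.Theory.
Local Open Scope ring_scope.

(* The ring Z_2 of 2-adic integers is the inverse limit of the rings Z/2^n:
   an element is a sequence of residues res n < 2^n (the bound follows from
   res_coherent) that are compatible with the reductions. *)
Record Z2 := MkZ2 {
  res : nat -> nat;
  res_coherent : forall n, res n = (res n.+1 %% 2 ^ n)%N }.

HB.instance Definition _ := gen_eqMixin Z2.
HB.instance Definition _ := gen_choiceMixin Z2.

Lemma Z2_eq (x y : Z2) : (forall n, res x n = res y n) -> x = y.
Proof.
case: x y => [f fP] [g gP] /= /funext efg; move: gP; rewrite -efg => gP.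
by congr MkZ2; exact: Prop_irrelevance.
Qed.

Lemma res_mod (x : Z2) n : (res x n %% 2 ^ n = res x n)%N.
Proof. by rewrite res_coherent modn_mod. Qed.

Lemma res_modS (x : Z2) n : res x n.+1 = res x n %[mod 2 ^ n].
Proof. by rewrite [in RHS]res_coherent modn_mod. Qed.

Section Z2Ring.

Lemma Z2_of_subproof (f : nat -> nat) :
  (forall n, f n.+1 = f n %[mod 2 ^ n]) ->
  forall n, (f n %% 2 ^ n = (f n.+1 %% 2 ^ n.+1) %% 2 ^ n)%N.
Proof. by move=> fP n; rewrite modn_dvdm ?fP // expnS dvdn_mull. Qed.

Definition Z2_of (f : nat -> nat) (fP : forall n, f n.+1 = f n %[mod 2 ^ n]) :=
  MkZ2 (Z2_of_subproof fP).

Lemma const_subproof (k n : nat) : k = k %[mod 2 ^ n].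
Proof. by []. Qed.

Lemma add_subproof (x y : Z2) n :
  (res x n.+1 + res y n.+1 = res x n + res y n %[mod 2 ^ n])%N.
Proof. by rewrite -modnDm !res_modS modnDm. Qed.

Lemma mul_subproof (x y : Z2) n :
  (res x n.+1 * res y n.+1 = res x n * res y n %[mod 2 ^ n])%N.
Proof. by rewrite -modnMm !res_modS modnMm. Qed.

Lemma opp_subproof (x : Z2) n :
  ((2 ^ n.+1).-1 * res x n.+1 = (2 ^ n).-1 * res x n %[mod 2 ^ n])%N.
Proof.
apply/eqP; rewrite -(eqn_modDr (res x n)) -[X in _ == X %[mod _]]mulSnr.
rewrite prednK ?expn_gt0 // modnMr -modnDmr -res_modS modnDmr -mulSnr.
by rewrite prednK ?expn_gt0 // expnS -mulnA mulnCA modnMr.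
Qed.

Definition Z2_zero := Z2_of (const_subproof 0).
Definition Z2_one := Z2_of (const_subproof 1).
Definition Z2_add x y := Z2_of (add_subproof x y).
Definition Z2_mul x y := Z2_of (mul_subproof x y).
(* Modulo 2 ^ n, the opposite of x is (2 ^ n - 1) * x. *)
Definition Z2_opp x := Z2_of (opp_subproof x).

Fact Z2_addA : associative Z2_add.
Proof. by move=> x y z; apply: Z2_eq => n /=; rewrite modnDml modnDmr addnA. Qed.
Fact Z2_addC : commutative Z2_add.
Proof. by move=> x y; apply: Z2_eq => n /=; rewrite addnC. Qed.
Fact Z2_add0 : left_id Z2_zero Z2_add.
Proof. by move=> x; apply: Z2_eq => n /=; rewrite mod0n add0n res_mod. Qed.
Fact Z2_addN : left_inverse Z2_zero Z2_opp Z2_add.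
Proof.
move=> x; apply: Z2_eq => n /=.
by rewrite modnDml -mulSnr prednK ?expn_gt0 // modnMr mod0n.
Qed.
Fact Z2_mulA : associative Z2_mul.
Proof. by move=> x y z; apply: Z2_eq => n /=; rewrite modnMml modnMmr mulnA. Qed.
Fact Z2_mulC : commutative Z2_mul.
Proof. by move=> x y; apply: Z2_eq => n /=; rewrite mulnC. Qed.
Fact Z2_mul1 : left_id Z2_one Z2_mul.
Proof. by move=> x; apply: Z2_eq => n /=; rewrite modnMml mul1n res_mod. Qed.
Fact Z2_mulDl : left_distributive Z2_mul Z2_add.
Proof.
by move=> x y z; apply: Z2_eq => n /=; rewrite modnMml modnDm mulnDl.
Qed.
Fact Z2_1neq0 : Z2_one != Z2_zero.
Proof. by apply/eqP => /(congr1 (fun x => res x 1)). Qed.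

HB.instance Definition _ :=
  GRing.isZmodule.Build Z2 Z2_addA Z2_addC Z2_add0 Z2_addN.
HB.instance Definition _ := GRing.Zmodule_isComNzRing.Build Z2
  Z2_mulA Z2_mulC Z2_mul1 Z2_mulDl Z2_1neq0.

Definition Z2_unit (x : Z2) : bool := `[< exists y : Z2, y * x = 1 >].

Definition Z2_inv (x : Z2) : Z2 :=
  if pselect (exists y : Z2, y * x = 1) is left ex then projT1 (cid ex) else x.

Fact Z2_mulVx : {in Z2_unit, left_inverse 1 Z2_inv *%R}.
Proof.
move=> x; rewrite unfold_in => /asboolP ux; rewrite /Z2_inv.
by case: pselect => // ex; case: cid.
Qed.
Fact Z2_unitPl (x y : Z2) : y * x = 1 -> Z2_unit x.
Proof. by move=> yx1; apply/asboolP; exists y. Qed.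
Fact Z2_inv_out : {in [predC Z2_unit], Z2_inv =1 id}.
Proof.
move=> x; rewrite inE /= unfold_in => /asboolP nux; rewrite /Z2_inv.
by case: pselect.
Qed.

HB.instance Definition _ := GRing.ComNzRing_hasMulInverse.Build Z2
  Z2_mulVx Z2_unitPl Z2_inv_out.

Lemma res_add (x : Z2) m n : res x (m + n) = res x m %[mod 2 ^ m].
Proof.
elim: n => [|n IHn]; first by rewrite addn0.
rewrite -IHn addnS; have d : (2 ^ m %| 2 ^ (m + n))%N by rewrite expnD dvdn_mulr.
by rewrite -(modn_dvdm _ d) res_modS modn_dvdm.
Qed.

Fact Z2_idomain : GRing.integral_domain_axiom Z2.
Proof.
move=> x y xy0; apply: contraT; rewrite negb_or => /andP[nx ny].
have nz (z : Z2) : z != 0 -> exists n, res z n <> 0%N.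
  move=> /eqP nz0; apply: contrapT => /forallNP h; apply: nz0; apply: Z2_eq => n.
  by rewrite [RHS]mod0n; have /contrapT := h n.
have [[i xi] [j yj]] := (nz _ nx, nz _ ny).
have /(congr1 (fun z => res z (i + j)))/= := xy0; rewrite mod0n => /eqP.
rewrite -/(dvdn _ _) => dxy.
have ndiv (z : Z2) k l : res z k <> 0%N -> ~~ (2 ^ k %| res z (k + l))%N.
  by move=> zk; apply/negP; rewrite /dvdn res_add res_mod => /eqP.
have ndx := ndiv x i j xi; have := ndiv y j i yj; rewrite addnC => ndy.
have x0 : (0 < res x (i + j))%N by case: (res x _) ndx; rewrite ?dvdn0.
have y0 : (0 < res y (i + j))%N by case: (res y _) ndy; rewrite ?dvdn0.
move: dxy ndx ndy; rewrite !pfactor_dvdn ?muln_gt0 ?x0 ?y0 // lognM // -!ltnNge.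
by move=> le lx ly; have := leq_add lx (ltnW ly); rewrite addSn ltnNge le.
Qed.

HB.instance Definition _ := GRing.ComUnitRing_isIntegral.Build Z2 Z2_idomain.

End Z2Ring.

Definition Q2 := {fraction Z2}.
HB.instance Definition _ := GRing.Field.on Q2.

Section RingOfIntegers.
Variables (F : fieldType) (iota : {rmorphism Q2 -> F}).

Definition Z2_to : Z2 -> F := iota \o @tofrac Z2.
HB.instance Definition _ := GRing.RMorphism.on Z2_to.

(* Integral closure of Z_2 in F. *)
Definition is_integer : {pred F} := fun x => `[< integralOver Z2_to x >].

Fact is_integer_subring : subring_closed is_integer.
Proof.
split; first by apply/asboolP; exact: integral1.
  by move=> x y /asboolP ix /asboolP iy; apply/asboolP; exact: integral_sub.
by move=> x y /asboolP ix /asboolP iy; apply/asboolP; exact: integral_mul.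
Qed.

HB.instance Definition _ :=
  GRing.isSubringClosed.Build F is_integer is_integer_subring.

Record ring_of_integers := RingOfIntegers {
  int_val :> F;
  _ : int_val \in is_integer }.

HB.instance Definition _ := [isSub for int_val].
HB.instance Definition _ := [Choice of ring_of_integers by <:].
HB.instance Definition _ :=
  [SubChoice_isSubComNzRing of ring_of_integers by <:].

End RingOfIntegers.

Section Ideals.
Variable R : comNzRingType.

(* idealr_closed includes properness (1 \notin I). *)
Definition maximal_ideal (I : {pred R}) : Prop :=
  idealr_closed I /\
  forall J : {pred R}, idealr_closed J -> {subset I <= J} -> I =i J.

Definition ideal_mul (I J : {pred R}) : {pred R} := fun x =>
  `[< exists s : seq (R * R),
        {in s, forall u, u.1 \in I /\ u.2 \in J} /\
        x = \sum_(u <- s) u.1 * u.2 >].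

Fixpoint ideal_exp (I : {pred R}) (n : nat) : {pred R} :=
  if n is n'.+1 then ideal_mul I (ideal_exp I n') else predT.

Definition principal_ideal (a : R) : {pred R} := fun x =>
  `[< exists y, x = y * a >].

End Ideals.

(* The maximal ideal 2 Z_2 of the base generates p ^ e in the ring of integers
   with prime p; as 2 is then a unit times the e-th power of a uniformizer, this
   says v(2) = e for the normalized valuation v. *)
Definition ramification_index (F : fieldType) (iota : {rmorphism Q2 -> F})
    (p : {pred ring_of_integers iota}) (e : nat) : Prop :=
  principal_ideal (2%:R : ring_of_integers iota) =i ideal_exp p e.

Section SL2.
Variable F : fieldType.

Record SL2 := MkSL2 {
  SL2_val :> 'M[F]_2;
  _ : \det SL2_val == 1 }.

HB.instance Definition _ := [isSub for SL2_val].
HB.instance Definition _ := [Choice of SL2 by <:].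

Fact SL2_det (A : SL2) : \det A = 1. Proof. by case: A => A /= /eqP. Qed.
Fact SL2_one_subproof : \det (1%:M : 'M[F]_2) == 1. Proof. by rewrite det1. Qed.
Fact SL2_mul_subproof (A B : SL2) : \det (A *m B) == 1.
Proof. by rewrite det_mulmx !SL2_det mulr1. Qed.
Fact SL2_inv_subproof (A : SL2) : \det (invmx A) == 1.
Proof. by rewrite det_inv SL2_det invr1. Qed.

Definition SL2_one := MkSL2 SL2_one_subproof.
Definition SL2_mul A B := MkSL2 (SL2_mul_subproof A B).
Definition SL2_inv A := MkSL2 (SL2_inv_subproof A).

Fact SL2_unit (A : SL2) : (A : 'M_2) \in unitmx.
Proof. by rewrite unitmxE SL2_det unitr1. Qed.
Fact SL2_mulA : associative SL2_mul.
Proof. by move=> A B C; apply: val_inj; rewrite /= mulmxA. Qed.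
Fact SL2_mul1 : left_id SL2_one SL2_mul.
Proof. by move=> A; apply: val_inj; rewrite /= mul1mx. Qed.
Fact SL2_mulr1 : right_id SL2_one SL2_mul.
Proof. by move=> A; apply: val_inj; rewrite /= mulmx1. Qed.
Fact SL2_mulV : left_inverse SL2_one SL2_inv SL2_mul.
Proof. by move=> A; apply: val_inj; rewrite /= mulVmx ?SL2_unit. Qed.
Fact SL2_mulrV : right_inverse SL2_one SL2_inv SL2_mul.
Proof. by move=> A; apply: val_inj; rewrite /= mulmxV ?SL2_unit. Qed.

HB.instance Definition _ := isGroup.Build SL2
  SL2_mulA SL2_mul1 SL2_mulr1 SL2_mulV SL2_mulrV.

End SL2.

Section Congruence.
Variables (F : fieldType) (iota : {rmorphism Q2 -> F}).
Local Notation O := (ring_of_integers iota).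

(* SL_2(o), viewed inside SL_2(F). *)
Definition SL2_int : {pred SL2 F} := fun A =>
  `[< exists X : 'M[O]_2, (A : 'M_2) = map_mx (@int_val F iota) X >].

Definition K_ (p : {pred O}) (n m : nat) : {pred SL2 F} := fun A =>
  `[< exists a b c d : O,
        [/\ a \in ideal_exp p n, d \in ideal_exp p n,
            b \in ideal_exp p (n + m), c \in ideal_exp p (n + m)
          & (A : 'M_2) = 1%:M +
              \matrix_(i < 2, j < 2)
                (if i == 0 then if j == 0 then a : F else b
                 else if j == 0 then c : F else d)] >].

End Congruence.

Definition normal_subgroup (gT : groupType) (H G : {pred gT}) : Prop :=
  [/\ group_closed G, group_closed H, {subset H <= G}
    & forall g h : gT, g \in G -> h \in H -> (h ^ g)%g \in H].

(* Main.v *)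
From HB Require Import structures.
Require Import Defs.
From mathcomp Require Import all_boot all_order all_algebra.
From mathcomp Require Import boolp ring.

Set Implicit Arguments.
Unset Strict Implicit.
Unset Printing Implicit Defensive.

Import GRing.Theory.

Local Open Scope ring_scope.

(** Write I = p ^ n and J = p ^ (n + m), and let X be an integral matrix of
determinant 1 with diagonal entries 1 + a, 1 + d for a, d in I, and with
off-diagonal entries b, c in J.  Expanding the determinant gives
a + d = b c - a d, which lies in J because I I = p ^ (2 n) is contained in J
when m <= n.  Moreover 2 a lies in p ^ (e + n), which is contained in J when
m <= e.  Hence d - a = (a + d) - 2 a lies in J: modulo J the matrix X is the
scalar 1 + a.  So K_n^m consists of the matrices of SL_2(o) that are congruent
modulo J to a scalar s with s congruent to 1 modulo I ([mem_K]).  Since scalars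
are central, that description is visibly stable under products and conjugation
([scalar_modM], [scalar_modJ]); it is stable under inverses because 2 - s is an
inverse of s modulo J, again by I I <= J ([scalar_modV]).

The argument uses only multiplication of powers of an ideal, so it takes place
over an arbitrary commutative ring, and transfers to SL_2(F) through the
inclusion of o in F. *)

(** * Two by two matrices *)

Lemma ord2_cases (i : 'I_2) : i = 0 \/ i = 1.
Proof. by case: i => [[|[|//]] hi]; [left | right]; apply: val_inj. Qed.

Lemma det_mx22 (R : comNzRingType) (X : 'M[R]_2) :
  \det X = X 0 0 * X 1 1 - X 0 1 * X 1 0.
Proof.
have lift0 : lift 0 0 = 1 :> 'I_2 by apply: val_inj.
have lift1 : lift 1 0 = 0 :> 'I_2 by apply: val_inj.
rewrite (expand_det_row _ 0) !big_ord_recl big_ord0 /cofactor !det_mx11 !mxE.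
by rewrite lift0 lift1 /= !add0n expr0 expr1 mul1r mulN1r mulrN addr0.
Qed.

(** * Powers of an ideal *)

Section IdealPowers.
Variable R : comNzRingType.
Implicit Types (I J p : {pred R}) (x y : R).

(** Unlike [idealr_closed], this admits the unit ideal, which occurs as p ^ 0. *)
Definition ideal I : Prop :=
  0 \in I /\ forall a, {in I &, forall x y, a * x + y \in I}.

Section Theory.
Variables (I : {pred R}) (idI : ideal I).

Lemma ideal0 : 0 \in I. Proof. by case: idI. Qed.

Lemma idealD x y : x \in I -> y \in I -> x + y \in I.
Proof. by case: idI => _ h xI yI; rewrite -[x]mul1r h. Qed.

Lemma idealMl a x : x \in I -> a * x \in I.
Proof. by case: idI => I0 h xI; rewrite -[_ * _]addr0 h. Qed.

Lemma idealMr a x : x \in I -> x * a \in I.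
Proof. by rewrite mulrC; apply: idealMl. Qed.

Lemma idealN x : x \in I -> - x \in I.
Proof. by move=> xI; rewrite -mulN1r idealMl. Qed.

Lemma idealB x y : x \in I -> y \in I -> x - y \in I.
Proof. by move=> xI yI; rewrite idealD ?idealN. Qed.

Lemma ideal_sum (T : eqType) (r : seq T) (f : T -> R) :
  {in r, forall t, f t \in I} -> \sum_(t <- r) f t \in I.
Proof.
move=> fI; rewrite big_seq; apply: (big_ind (fun x => x \in I)) => //.
- exact: ideal0.
- by move=> x y; apply: idealD.
Qed.

End Theory.

Lemma mem_ideal_mul I J x y : x \in I -> y \in J -> x * y \in ideal_mul I J.
Proof.
move=> xI yJ; apply/asboolP; exists [:: (x, y)]; split.
  by move=> u; rewrite inE => /eqP ->.
by rewrite big_seq1.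
Qed.

Lemma ideal_ideal_mul I J : ideal I -> ideal (ideal_mul I J).
Proof.
move=> idI; split; first by apply/asboolP; exists [::]; rewrite big_nil.
move=> a x y /asboolP[s [sIJ ->]] /asboolP[t [tIJ ->]].
apply/asboolP; exists ([seq (a * u.1, u.2) | u <- s] ++ t); split.
  move=> u; rewrite mem_cat => /orP[/mapP[v vs ->]|/tIJ //] /=.
  by have [vI vJ] := sIJ v vs; split=> //; apply: idealMl.
rewrite big_cat big_map mulr_sumr /=; congr (_ + _).
by apply: eq_bigr => u _; rewrite mulrA.
Qed.

Section Powers.
Variables (p : {pred R}) (idp : ideal p).

Lemma ideal_ideal_exp k : ideal (ideal_exp p k).
Proof. by case: k => [|k]; [split | apply: ideal_ideal_mul]. Qed.

Lemma mem_ideal_expD i j x y :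
  x \in ideal_exp p i -> y \in ideal_exp p j -> x * y \in ideal_exp p (i + j).
Proof.
move=> xi yj; elim: i x xi => [|i IHi] x.
  by move=> _; apply/idealMl/yj/ideal_ideal_exp.
move=> /asboolP[s [spi ->]]; rewrite mulr_suml.
apply: ideal_sum; first exact: ideal_ideal_exp.
by move=> u us; have [u1 u2] := spi u us; rewrite -mulrA mem_ideal_mul ?IHi.
Qed.

Lemma sub_ideal_exp i j :
  (i <= j)%N -> {subset ideal_exp p j <= ideal_exp p i}.
Proof.
move=> /subnK <-; elim: (j - i)%N => // k IHk x /asboolP[s [spk ->]].
apply: ideal_sum; first exact: ideal_ideal_exp.
move=> u us; have [_ u2] := spk u us.
by apply/idealMl/IHk/u2/ideal_ideal_exp.
Qed.

End Powers.
End IdealPowers.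

(** * Matrices that are scalar modulo an ideal *)

Section ScalarModulo.
Variables (R : comNzRingType) (I J : {pred R}).
Hypotheses (idI : ideal I) (idJ : ideal J).
Hypothesis I2J : {in I &, forall x y, x * y \in J}.

Definition mx_in k (M : 'M[R]_k) : Prop := forall i j, M i j \in J.

Lemma mx_inD k (M N : 'M[R]_k) : mx_in M -> mx_in N -> mx_in (M + N).
Proof. by move=> MJ NJ i j; rewrite mxE idealD. Qed.

Lemma mx_inMl k (U M : 'M[R]_k) : mx_in M -> mx_in (U *m M).
Proof. by move=> MJ i j; rewrite mxE ideal_sum // => t _; apply: idealMl. Qed.

Lemma mx_inMr k (U M : 'M[R]_k) : mx_in M -> mx_in (M *m U).
Proof. by move=> MJ i j; rewrite mxE ideal_sum // => t _; apply: idealMr. Qed.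

Lemma mx_in_scalar k s : s \in J -> mx_in (s%:M : 'M[R]_k).
Proof. by move=> sJ i j; rewrite mxE; case: eqP; rewrite ?mulr1n ?ideal0. Qed.

Definition scalar_mod k (X : 'M[R]_k) : Prop :=
  exists2 s, s - 1 \in I & mx_in (X - s%:M).

Lemma scalar_mod1 k : scalar_mod (1%:M : 'M[R]_k).
Proof.
exists 1; first by rewrite subrr ideal0.
by rewrite subrr => i j; rewrite mxE ideal0.
Qed.

Lemma scalar_modM k (X Y : 'M[R]_k) :
  scalar_mod X -> scalar_mod Y -> scalar_mod (X *m Y).
Proof.
move=> [s sI Xs] [t tI Yt]; exists (s * t).
  have -> : s * t - 1 = s * (t - 1) + (s - 1) by ring.
  by rewrite idealD ?idealMl.
have -> : X *m Y - (s * t)%:M = X *m (Y - t%:M) + (X - s%:M) *m t%:M.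
  by rewrite mulmxBr mulmxBl -scalar_mxM addrA subrK.
by apply: mx_inD; [apply: mx_inMl | apply: mx_inMr].
Qed.

Lemma scalar_modJ k (U V X : 'M[R]_k) :
  V *m U = 1%:M -> scalar_mod X -> scalar_mod (V *m (X *m U)).
Proof.
move=> VU1 [s sI Xs]; exists s => //.
have -> : V *m (X *m U) - s%:M = V *m ((X - s%:M) *m U).
  by rewrite mulmxBl mulmxBr -scalar_mxC [V *m (U *m _)]mulmxA VU1 mul1mx.
by apply/mx_inMl/mx_inMr.
Qed.

Lemma scalar_modV k (X Y : 'M[R]_k) :
  Y *m X = 1%:M -> scalar_mod X -> scalar_mod Y.
Proof.
move=> YX1 [s sI Xs].
(* 2 - s inverts s modulo J, as 1 - s * (2 - s) = (s - 1) ^ 2 is in I I. *)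
exists (2%:R - s).
  have -> : 2%:R - s - 1 = - (s - 1) by ring.
  by rewrite idealN.
have -> : Y - (2%:R - s)%:M
    = Y *m (((s - 1) * (s - 1))%:M + (X - s%:M) *m (s - 2%:R)%:M).
  rewrite mulmxBl -scalar_mxM addrCA -raddfB /=.
  have -> : (s - 1) * (s - 1) - s * (s - 2%:R) = 1 by ring.
  by rewrite mulmxDr mulmxA YX1 mul1mx mulmx1 -(opprB s) raddfN opprK addrC.
by apply/mx_inMl/mx_inD; [apply/mx_in_scalar/I2J | apply: mx_inMr].
Qed.

Hypotheses (JI : {subset J <= I}) (dblI : {in I, forall x, 2%:R * x \in J}).

(** The determinant condition puts the sum of X 0 0 - 1 and X 1 1 - 1 in J;
because doubling maps I into J, this controls their difference as well, so the
two diagonal entries agree modulo J. *)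
Lemma scalar_mod2P (X : 'M[R]_2) : \det X = 1 ->
  scalar_mod X <-> [/\ X 0 0 - 1 \in I, X 1 1 - 1 \in I, X 0 1 \in J
                     & X 1 0 \in J].
Proof.
move=> detX; split=> [[s sI Xs]|[aI dI bJ cJ]].
  have diag i : X i i - 1 \in I.
    have -> : X i i - 1 = (X i i - s) + (s - 1) by ring.
    rewrite idealD //; apply: JI; have := Xs i i.
    by rewrite !mxE eqxx mulr1n.
  by split=> //; [have := Xs 0 1 | have := Xs 1 0]; rewrite !mxE mulr0n subr0.
exists (X 0 0) => //.
have dJ : X 1 1 - X 0 0 \in J.
  have -> : X 1 1 - X 0 0 = X 0 1 * X 1 0 - (X 0 0 - 1) * (X 1 1 - 1)
                          - 2%:R * (X 0 0 - 1).
    have -> : X 0 1 * X 1 0 = X 0 0 * X 1 1 - 1.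
      by rewrite -detX det_mx22 opprB addrC subrK.
    by ring.
  apply: idealB (dblI aI) => //.
  by apply: idealB (I2J aI dI) => //; apply: idealMl.
move=> i j; rewrite !mxE.
by case: (ord2_cases i) => ->; case: (ord2_cases j) => ->;
  rewrite ?mulr1n ?mulr0n ?subr0 ?subrr ?ideal0.
Qed.

End ScalarModulo.

(** * The congruence subgroups of SL_2 *)

Section Congruence.
Variables (F : fieldType) (iota : {rmorphism Q2 -> F}).
Local Notation O := (ring_of_integers iota).
HB.instance Definition _ :=
  GRing.RMorphism.copy (@int_val F iota) (val : O -> F).
Local Notation intmx := (map_mx (@int_val F iota)).

Lemma SL2_intP (A : SL2 F) :
  A \in SL2_int iota <-> exists X : 'M[O]_2, (A : 'M_2) = intmx X.
Proof. by split=> /asboolP. Qed.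

Lemma det_intmx (A : SL2 F) (X : 'M[O]_2) :
  (A : 'M_2) = intmx X -> \det X = 1.
Proof.
move=> AX; apply: (@val_inj _ _ O).
by have := SL2_det A; rewrite AX det_map_mx.
Qed.

(** The adjugate is the inverse up to the determinant and is defined over any
ring, so inverses in SL_2(F) of integral matrices are integral. *)
Lemma intmxV (A : SL2 F) (X : 'M[O]_2) :
  (A : 'M_2) = intmx X -> ((A^-1)%g : 'M_2) = intmx (\adj X).
Proof.
move=> AX; rewrite map_mx_adj -AX /= /invmx SL2_unit SL2_det.
by rewrite invr1 scale1r.
Qed.

Lemma intmxM (A B : SL2 F) (X Y : 'M[O]_2) :
  (A : 'M_2) = intmx X -> (B : 'M_2) = intmx Y ->
  ((A * B)%g : 'M_2) = intmx (X *m Y).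
Proof. by move=> AX BY; rewrite map_mxM -AX -BY. Qed.

Lemma group_closed_SL2_int : group_closed (SL2_int iota).
Proof.
split; first by apply/SL2_intP; exists 1%:M; rewrite map_mx1.
move=> A B /SL2_intP[X AX] /SL2_intP[Y BY].
by apply/SL2_intP; exists (X *m \adj Y); apply/intmxM/intmxV.
Qed.

Variables (p : {pred O}) (e n m : nat).
Hypotheses (idp : ideal p) (he : ramification_index p e).
Hypotheses (hem : (m <= e)%N) (hnm : (m <= n)%N).
Local Notation I := (ideal_exp p n).
Local Notation J := (ideal_exp p (n + m)).

Lemma ideal_exp_sqr : {in I &, forall x y, x * y \in J}.
Proof.
move=> x y xI yI; apply: (@sub_ideal_exp _ _ idp _ (n + n)).
  by rewrite leq_add2l.
exact: mem_ideal_expD.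
Qed.

Lemma ideal_exp_double : {in I, forall x, 2%:R * x \in J}.
Proof.
move=> x xI; apply: (@sub_ideal_exp _ _ idp _ (e + n)).
  by rewrite addnC leq_add2r.
apply: mem_ideal_expD => //; rewrite -he; apply/asboolP.
by exists 1; rewrite mul1r.
Qed.

(** Over o, the entrywise conditions defining K_n^m become the basis-free
congruence for which closure properties hold in any dimension. *)
Lemma mem_K (A : SL2 F) :
  A \in K_ p n m <->
  exists2 X : 'M[O]_2, (A : 'M_2) = intmx X & scalar_mod I J X.
Proof.
have [idI idJ] := (ideal_ideal_exp idp n, ideal_ideal_exp idp (n + m)).
have JI : {subset J <= I} by apply: sub_ideal_exp => //; rewrite leq_addr.
have smP X AX := scalar_mod2P idI idJ ideal_exp_sqr JI ideal_exp_double
  (@det_intmx A X AX).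
split=> [/asboolP[a [b [c [d [aI dI bJ cJ AE]]]]]|[X AX]].
  pose X : 'M[O]_2 := 1%:M + \matrix_(i, j)
    (if i == 0 then if j == 0 then a else b else if j == 0 then c else d).
  have AX : (A : 'M_2) = intmx X.
    rewrite AE map_mxD map_mx1; congr (_ + _); apply/matrixP => i j.
    by rewrite !mxE; do 2 case: ifP.
  exists X => //; apply/(smP X AX).
  by rewrite !mxE /= !mulr1n !mulr0n !add0r ![1 + _]addrC !addrK.
move=> /(smP X AX)[aI dI bJ cJ]; apply/asboolP.
exists (X 0 0 - 1), (X 0 1), (X 1 0), (X 1 1 - 1); split=> //.
rewrite AX; apply/matrixP => i j; rewrite !mxE.
by case: (ord2_cases i) => ->; case: (ord2_cases j) => -> /=;
  rewrite ?mulr1n ?mulr0n ?add0r // addrC subrK.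
Qed.

Lemma group_closed_K : group_closed (K_ p n m).
Proof.
have [idI idJ] := (ideal_ideal_exp idp n, ideal_ideal_exp idp (n + m)).
split.
  by apply/mem_K; exists 1%:M; [rewrite map_mx1 | apply: scalar_mod1].
move=> A B /mem_K[X AX sX] /mem_K[Y BY sY]; apply/mem_K.
exists (X *m \adj Y); first exact/intmxM/intmxV.
apply: scalar_modM => //; apply: (scalar_modV idI idJ ideal_exp_sqr _ sY).
by rewrite mul_adj_mx (det_intmx BY).
Qed.

Lemma conjg_K (g h : SL2 F) :
  g \in SL2_int iota -> h \in K_ p n m -> (h ^ g)%g \in K_ p n m.
Proof.
move=> /SL2_intP[U gU] /mem_K[X hX sX]; apply/mem_K.
exists (\adj U *m (X *m U)); first exact: intmxM (intmxV gU) (intmxM hX gU).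
apply: scalar_modJ => //; first exact: ideal_ideal_exp.
by rewrite mul_adj_mx (det_intmx gU).
Qed.

End Congruence.

Theorem theorem1 (F : fieldType) (iota : {rmorphism Q2 -> F})
    (hF : forall x : F, algebraicOver iota x)
    (p : {pred ring_of_integers iota}) (hp : maximal_ideal p)
    (e : nat) (he : ramification_index p e)
    (n m : nat) (hem : (m <= e)%N) (hnm : (m <= n)%N) :
  normal_subgroup (K_ p n m) (SL2_int iota).
Proof.
have idp : ideal p by case: hp => -[p0 _ pD] _; split.
split.
- exact: group_closed_SL2_int.
- exact: (group_closed_K idp he hem hnm).
- by move=> A /(mem_K idp he hem hnm)[X AX _]; apply/SL2_intP; exists X.
- exact: (conjg_K idp he hem hnm).
Qed.
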